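(* Let $n>p\ge 2$ be integers and let $G\in\mathbb{G}_n^p$, i.e. $G$ is a connected simple graph with $n$ vertices, exactly $p$ of which are pendant. Write $p=\ell(n-p)+t$ with integers $\ell\ge 0$ and $0\le t\le n-p-1$. Then $$\prod\nolimits_1(G)\le (n+\ell-p)^{2t}\,(n+\ell-p-1)^{2(n-p-t)}\quad\text{and}\quad \prod\nolimits_2(G)\le (n-1)^{n-1}\,(n-p-1)^{(n-p-1)^2},$$ where equality holds in the first inequality if and only if $G\cong G_a$, and in the second if and only if $G\cong G_s$.
   Context: All graphs are finite, simple and connected. $d(u)$ is the degree of a vertex $u$; a pendant vertex is a vertex of degree $1$. The first and second multiplicative Zagreb indices are $\prod_1(G)=\prod_{u\in V(G)}d(u)^2$ and $\prod_2(G)=\prod_{uv\in E(G)}d(u)d(v)=\prod_{u\in V(G)}d(u)^{d(u)}$. The convention $0^0=1$ is used. $\mathbb{G}_n^p$ is the set of connected graphs with $n$ vertices and exactly $p\ge2$ pendant vertices. $G_a$ is the $n$-vertex graph obtained from the complete graph $K_{n-p}$ on vertices $v_1,\dots,v_{n-p}$ by attaching $n_i$ new degree-one vertices to $v_i$ for each $i$, where $\sum_{i=1}^{n-p} n_i=p$ and $|n_i-n_j|\le 1$ for all $i,j$ (so $t$ of the $n_i$ equal $\ell+1$ and the remaining $n-p-t$ equal $\ell$). $G_s$ is the $n$-vertex graph obtained from $K_{n-p}$ by attaching $p$ new degree-one vertices all to one and the same vertex of $K_{n-p}$. *)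

(* Defs.v *)
From HB Require Import structures.
From mathcomp Require Import all_boot.

Set Implicit Arguments.
Unset Strict Implicit.
Unset Printing Implicit Defensive.

Record sgraph := SGraph {
  vertex :> finType;
  adj : rel vertex;
  adj_sym : symmetric adj;
  adj_irrefl : irreflexive adj }.

Definition edges (G : sgraph) : {set {set G}} :=
  [set A | [exists u : G, exists v : G, adj u v && (A == [set u; v])]].

Definition deg (G : sgraph) (u : G) : nat := #|[set v | adj u v]|.

Definition pendant (G : sgraph) (u : G) : bool := deg u == 1.

Definition connected (G : sgraph) : Prop :=
  forall u v : G, connect (@adj G) u v.

Definition connected_pendant (n p : nat) (G : sgraph) : Prop :=
  [/\ connected G, #|G| = n & #|[set u : G | pendant u]| = p].

Definition graph_iso (G H : sgraph) : Prop :=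
  exists2 f : G -> H, bijective f & forall u v, adj (f u) (f v) = adj u v.

Definition mult_zagreb1 (G : sgraph) : nat := \prod_(u : G) deg u ^ 2.

(* As G has no loops, an edge A = [set u; v] has exactly two elements, so the
   inner product is deg u * deg v. *)
Definition mult_zagreb2 (G : sgraph) : nat :=
  \prod_(A in edges G) \prod_(u in A) deg u.

Section CliquePendants.
Variables (m : nat) (c : 'I_m -> nat).

(* [inl i] is the clique vertex v_i; [inr (Tagged _ k)] with tag i is the k-th
   of the c i new vertices attached to v_i. *)
Definition clique_pendants_vertex : finType :=
  ('I_m + {i : 'I_m & 'I_(c i)})%type.

Definition clique_pendants_adj : rel clique_pendants_vertex := fun x y =>
  match x, y with
  | inl i, inl j => i != j
  | inl i, inr w => i == tag w
  | inr w, inl i => i == tag w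
  | inr _, inr _ => false
  end.

Lemma clique_pendants_sym : symmetric clique_pendants_adj.
Proof. by case=> [i|w] [j|w'] //=; rewrite eq_sym. Qed.

Lemma clique_pendants_irrefl : irreflexive clique_pendants_adj.
Proof. by case=> [i|w] //=; rewrite eqxx. Qed.

Definition clique_pendants : sgraph :=
  SGraph clique_pendants_sym clique_pendants_irrefl.

End CliquePendants.

(* G_a and G_s are defined up to isomorphism only: the order of the c i,
   respectively the choice of the vertex k, is immaterial. *)
Definition iso_Ga (n p : nat) (G : sgraph) : Prop :=
  exists c : 'I_(n - p) -> nat,
    [/\ \sum_(i < n - p) c i = p,
        forall i j, c i <= c j + 1
      & graph_iso G (clique_pendants c)].

Definition iso_Gs (n p : nat) (G : sgraph) : Prop :=
  exists k : 'I_(n - p),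
    graph_iso G (clique_pendants (fun i => if i == k then p else 0)).

(* Main.v *)
Require Import Defs.
From HB Require Import structures.
From mathcomp Require Import all_boot.
From mathcomp Require Import zify.
Set Implicit Arguments.
Unset Strict Implicit.
Unset Printing Implicit Defensive.

(** With m = n - p non-pendant vertices, c_u of the pendant vertices hang at the
    non-pendant vertex u, and d(u) <= m - 1 + c_u with equality for all u iff the
    non-pendant vertices form a clique. Since the c_u sum to p, both indices
    reduce to bounding a product of F (m - 1 + c_u) over the sequences c of sum p.
    For F x = x ^ 2, the line through the points q = m - 1 + l and q + 1 of the
    concave function ln dominates it at all integers, touching only there, so
    the maximum is the balanced c. For F x = x ^ x, ln F is strictly
    convex, hence below its chord on [m - 1, m - 1 + p], touching only at the
    ends, so the maximum has a single nonzero c_u. All inequalities are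
    exponentiated so as to live in nat. *)

(** * Strictly log-convex sequences and their chords *)

(** Bernoulli's inequality 1 - x / N <= (1 - 1 / N) ^ x, multiplied by N ^ (x + 1). *)
Lemma bernoulli_nat N x : x <= N -> N ^ x * (N - x) <= N * N.-1 ^ x.
Proof.
elim: x => [|x IHx] lexN; first by rewrite !expn0; lia.
have {}IHx := IHx (ltnW lexN); rewrite !expnS.
have : N * (N - x.+1) <= (N - x) * N.-1 by nia.
move: IHx; move: (N ^ x) (N.-1 ^ x) => a b le1 le2.
apply: (@leq_trans (a * ((N - x) * N.-1))); first by rewrite mulnAC mulnC leq_mul2l le2 orbT.
by rewrite mulnA mulnCA [leqRHS]mulnC leq_mul2r le1 orbT.
Qed.

Definition strictly_log_convex (g : nat -> nat) :=
  forall x, 0 < g x /\ g x.+1 ^ 2 < g x * g x.+2.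

(* After division by (x + 1) ^ (2 * x), the claim is Bernoulli's inequality for
   (1 - 1 / (x + 1) ^ 2) ^ x. At x = 0 it uses 0 ^ 0 = 1. *)
Lemma selfpow_log_convex : strictly_log_convex (fun x => x ^ x).
Proof.
move=> x; split; first by case: x => // x; rewrite expn_gt0.
case: x => // x; set y := x.+1.
have y0 : 0 < y by [].
have := @bernoulli_nat (y.+1 ^ 2) y ltac:(nia).
have -> : (y.+1 ^ 2).-1 = y * y.+2 by nia.
rewrite expnMn -expnM => B.
have -> : (y.+1 ^ y.+1) ^ 2 = y.+1 ^ (2 * y) * y.+1 ^ 2.
  by rewrite -expnM -expnD; congr (_ ^ _); lia.
have -> : y ^ y * y.+2 ^ y.+2 = y ^ y * y.+2 ^ y * y.+2 ^ 2.
  by rewrite -mulnA -expnD addn2.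
have lt1 : y.+1 ^ 2 * y.+1 ^ 2 < (y.+1 ^ 2 - y) * y.+2 ^ 2 by nia.
have a0 : 0 < y.+1 ^ (2 * y) by rewrite expn_gt0.
move: B lt1 a0 y0; move: (_ ^ (2 * y)) (y ^ y * _) (y.+1 ^ 2) (y.+2 ^ 2) => a b N M B lt1 a0 _.
have N0 : 0 < N by case: (N) B lt1 => //; lia.
rewrite -(ltn_pmul2l N0).
apply: (@leq_trans (a * (N - y) * M)); last by rewrite mulnA leq_mul2r B orbT.
by rewrite mulnCA -mulnA ltn_pmul2l.
Qed.

Lemma log_convex_shift k g :
  strictly_log_convex g -> strictly_log_convex (fun x => g (k + x)).
Proof. by move=> gP x; rewrite !addnS; apply: gP. Qed.

(** The ratios g (x + 1) / g x strictly increase; the local inequalities are chained and the common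
    factor [g y * g y.+1] is cancelled. *)
Lemma log_convex_cross g x y : strictly_log_convex g -> x < y ->
  g x.+1 * g y < g x * g y.+1.
Proof.
move=> gP; elim: y => // y IHy; rewrite ltnS leq_eqVlt => /predU1P[->|/IHy lt1].
  by rewrite mulnn; case: (gP y).
have [y0 lt2] := gP y; have [y1 _] := gP y.+1.
have lt3 := ltn_mul lt1 lt2.
have e0 : 0 < g y * g y.+1 by rewrite muln_gt0 y0.
rewrite -(ltn_pmul2r e0).
move: lt3; rewrite (_ : _ * _ ^ 2 = g x.+1 * g y.+1 * (g y * g y.+1)); last by nia.
by rewrite (_ : g x * g y.+1 * _ = g x * g y.+2 * (g y * g y.+1)) //; nia.
Qed.

(** The quotient g c / g 0 is a product of c successive ratios, each taken before y and so smaller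
    than g (y + 1) / g y. *)
Lemma log_convex_increment g c y : strictly_log_convex g -> 0 < c <= y ->
  g c * g y ^ c < g 0 * g y.+1 ^ c.
Proof.
move=> gP; elim: c => // -[_|c IHc] /andP[_ lecy].
  by rewrite !expn1 log_convex_cross.
have lt1 := log_convex_cross gP lecy.
have {}IHc := IHc (ltnW lecy).
have [c0 _] := gP c.+1.
rewrite -(ltn_pmul2r c0).
have lt2 := ltn_mul lt1 IHc.
rewrite ![_ ^ c.+2]expnS.
rewrite (_ : _ * g c.+1 = g c.+2 * g y * (g c.+1 * g y ^ c.+1)); last by nia.
by apply: (leq_trans lt2); nia.
Qed.

Lemma log_convex_chord_lt g c p : strictly_log_convex g -> 0 < c < p ->
  g c ^ p < g 0 ^ (p - c) * g p ^ c.
Proof.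
move=> gP /andP[c0]; elim: p => // p IHp; rewrite ltnS leq_eqVlt.
case/predU1P=> [<-|ltcp].
  by rewrite subSnn expn1 expnS log_convex_increment // c0 leqnn.
have {}IHp := IHp ltcp.
have p0 : 0 < p by apply: leq_trans ltcp.
(* Raising to the power p brings out [g p ^ p.+1], which the chord from 0 to p + 1 bounds at p. *)
rewrite -(ltn_exp2r _ _ p0) expnAC; apply: (@leq_trans ((g 0 ^ (p - c) * g p ^ c) ^ p.+1)).
  by rewrite ltn_exp2r.
rewrite !expnMn -!expnM [c * _]mulnC !expnM.
have le1 : g p ^ p.+1 <= g 0 * g p.+1 ^ p.
  by rewrite expnS ltnW // log_convex_increment // p0 leqnn.
apply: (@leq_trans ((g 0 ^ (p - c)) ^ p.+1 * (g 0 * g p.+1 ^ p) ^ c)).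
  by rewrite leq_mul2l leq_exp2r // le1 orbT.
rewrite expnMn mulnA -!expnM -expnD [c * p]mulnC.
by rewrite (_ : _ + c = (p.+1 - c) * p) //; nia.
Qed.

Lemma log_convex_chord g c p : strictly_log_convex g -> c <= p ->
  g c ^ p <= g 0 ^ (p - c) * g p ^ c ?= iff (c == 0) || (c == p).
Proof.
move=> gP lecp; have [->|c0] := posnP c.
  by rewrite subn0 muln1; apply/leqif_refl.
have [->|ltcp] := eqVneq c p; first by rewrite subnn mul1n orbT; apply/leqif_refl.
have ltc : c < p by rewrite ltn_neqAle ltcp.
have lt := log_convex_chord_lt gP (introT andP (conj c0 ltc)).
by split; [apply: ltnW | rewrite ltn_eqF].
Qed.

(** * Products of inequalities with their equality cases *)

Lemma leqif_prod (I : finType) (E F : I -> nat) (C : pred I) :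
  (forall i, 0 < F i) -> (forall i, E i <= F i ?= iff C i) ->
  \prod_i E i <= \prod_i F i ?= iff [forall i, C i].
Proof.
move=> F0 EF; have <- : \big[andb/true]_i C i = [forall i, C i] by rewrite big_andE.
(* Positivity is carried along the induction because a zero product on the right would force
   equality. *)
have: 0 < \prod_i F i /\ \prod_i E i <= \prod_i F i ?= iff \big[andb/true]_i C i.
  elim/big_ind3: _ => // x1 x2 x3 y1 y2 y3 [p1 h1] [p2 h2].
  split; first by rewrite muln_gt0 p1.
  by have := leqif_mul h1 h2; rewrite muln_eq0 !(gtn_eqF p1, gtn_eqF p2).
by case.
Qed.

Lemma prod_expn (I : finType) (E : I -> nat) e :
  \prod_i E i ^ e = (\prod_i E i) ^ e.
Proof. by rewrite (big_morph (expn^~ e) (fun x y => expnMn x y e) (exp1n e)). Qed.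

Lemma leqif_exp2r a b e C : 0 < e -> a ^ e <= b ^ e ?= iff C -> a <= b ?= iff C.
Proof. by move=> e0 [le eq]; split; rewrite -?eq ?eqn_exp2r // -(leq_exp2r _ _ e0). Qed.

(** The chord inequalities on [0, p] are multiplied; since the [c i] sum to p, the exponents add up
    to p times those claimed. *)
Lemma leqif_log_convex_prod (I : finType) g p (c : I -> nat) :
    strictly_log_convex g -> 0 < p -> \sum_i c i = p ->
  \prod_i g (c i) <= g 0 ^ (#|I| - 1) * g p
    ?= iff [forall i, (c i == 0) || (c i == p)].
Proof.
move=> gP p0 sumc; apply: (leqif_exp2r p0).
have lecp i : c i <= p by rewrite -sumc (bigD1 i) //= leq_addr.
have := @leqif_prod I _ (fun i => g 0 ^ (p - c i) * g p ^ c i) _ _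
  (fun i => log_convex_chord gP (lecp i)).
rewrite big_split -!expn_sum sumc prod_expn.
rewrite (_ : \sum_i (p - c i) = (#|I| - 1) * p); last first.
  apply/eqP; rewrite mulnBl mul1n -(eqn_add2r p); apply/eqP.
  rewrite -{2}sumc -big_split /= (eq_bigr (fun=> p)) => [|i _]; last by rewrite subnK.
  (* An empty [I] would give the sum 0, against 0 < p. *)
  rewrite sum_nat_const subnK //; case: (posnP #|I|) => [I0|]; last by move=> I0; rewrite leq_pmull.
  by move: p0; rewrite -sumc big_pred0 // => i; have := card0_eq I0 i.
rewrite expnM expnMn; apply => i.
by rewrite muln_gt0 !expn_gt0 !(proj1 (gP _)).
Qed.

(** * The secant bound and balanced products *)

(* Exponentiated form of ln x <= ln q + (x - q) * (ln (q + 1) - ln q), with the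
   denominators cleared. *)
Lemma leqif_secant q x : 0 < q ->
  x * (q.+1 ^ q * q ^ x) <= q * (q ^ q * q.+1 ^ x)
    ?= iff (x == q) || (x == q.+1).
Proof.
move=> q0; have [leqx|ltxq] := leqP q x.
  rewrite -(subnKC leqx); move: (x - q) => j.
  rewrite -[q.+1]addn1 !expnD.
  have -> : (q + j == q) || (q + j == q + 1) = (j == 0) || (j == 1) by lia.
  rewrite (_ : _ * _ = q ^ q * (q + 1) ^ q * ((q + j) * q ^ j)); last by nia.
  rewrite (_ : q * _ = q ^ q * (q + 1) ^ q * (q * (q + 1) ^ j)); last by nia.
  have p0 : 0 < q ^ q * (q + 1) ^ q by rewrite muln_gt0 !expn_gt0 q0 addn1.
  (* With x = q + j this is 1 + j / q <= (1 + 1 / q) ^ j, strict from j = 2 on. *)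
  suff [le eq] : (q + j) * q ^ j <= q * (q + 1) ^ j ?= iff (j == 0) || (j == 1).
    by split; rewrite ?leq_pmul2l ?eqn_pmul2l // gtn_eqF.
  have lt k : (q + k.+2) * q ^ k.+2 < q * (q + 1) ^ k.+2.
    elim: k => [|k IHk]; first by nia.
    rewrite 2![_ ^ k.+3]expnS; have : 0 < q ^ k.+2 by rewrite expn_gt0 q0.
    by move: IHk; move: (q ^ k.+2) ((q + 1) ^ k.+2) => a b; nia.
  case: j => [|[|j]]; first by rewrite addn0; apply/leqif_refl.
    by rewrite !expn1 mulnC; apply/leqif_refl.
  by split; [apply: ltnW | rewrite ltn_eqF].
rewrite -[x](subKn (ltnW ltxq)); have: q - x <= q by apply: leq_subr.
have: 0 < q - x by rewrite subn_gt0.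
move: (q - x) => {x ltxq} j j0 lejq.
rewrite (_ : (_ == _) || _ = false); last by lia.
(* With x = q - j this is 1 - j / q < (q / (q + 1)) ^ j, strict since j > 0. *)
suff lt: (q - j) * q.+1 ^ j < q * q ^ j.
  have p0 : 0 < q ^ (q - j) * q.+1 ^ (q - j) by rewrite muln_gt0 !expn_gt0 q0.
  have E b : b ^ q = b ^ (q - j) * b ^ j by rewrite -expnD subnK.
  rewrite !E.
  rewrite (_ : _ * _ = q ^ (q - j) * q.+1 ^ (q - j) * ((q - j) * q.+1 ^ j)); last by nia.
  rewrite (_ : q * _ = q ^ (q - j) * q.+1 ^ (q - j) * (q * q ^ j)); last by nia.
  by split; [rewrite leq_pmul2l // ltnW | rewrite eqn_pmul2l // ltn_eqF].
elim: j j0 lejq => // -[_ _ _|j IHj _ ltjq]; first by nia.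
have {}IHj := IHj isT (ltnW ltjq); rewrite 2![_ ^ j.+2]expnS.
by move: IHj; move: (q.+1 ^ j.+1) (q ^ j.+1) => a b; nia.
Qed.

(** In the product of the secant bounds the right-hand side depends only on the sum of the [x i]; a
    common factor then cancels. *)
Lemma leqif_prod_balanced (I : finType) (x : I -> nat) q t :
    0 < q -> t <= #|I| -> \sum_i x i = #|I| * q + t ->
  \prod_i x i <= q.+1 ^ t * q ^ (#|I| - t)
    ?= iff [forall i, (x i == q) || (x i == q.+1)].
Proof.
move=> q0 tI sumx.
have pos i : 0 < q * (q ^ q * q.+1 ^ x i) by rewrite !muln_gt0 !expn_gt0 q0.
have := leqif_prod pos (fun i => leqif_secant (x i) q0).
have sumq : \sum_(i : I) q = #|I| * q by rewrite sum_nat_const.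
rewrite !big_split /= -!expn_sum !prod_nat_const sumq sumx !expnD.
move=> -[le eq].
have p0 : 0 < q.+1 ^ (#|I| * q) * q ^ (#|I| * q) * q ^ t.
  by rewrite !muln_gt0 !expn_gt0 q0.
have e1 : q ^ #|I| = q ^ (#|I| - t) * q ^ t by rewrite -expnD subnK.
move: le eq; rewrite e1.
rewrite (_ : _ * (_ * _) = q.+1 ^ (#|I| * q) * q ^ (#|I| * q) * q ^ t * \prod_i x i); last by nia.
rewrite (_ : _ * (_ * (_ * _)) = q.+1 ^ (#|I| * q) * q ^ (#|I| * q) * q ^ t * (q.+1 ^ t * q ^ (#|I| - t))); last by nia.
by rewrite leq_pmul2l // eqn_pmul2l.
Qed.

(** * Pendant vertices, the core and degrees *)

Definition core (G : sgraph) : {set G} := [set u | ~~ pendant u].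

Definition leaves (G : sgraph) (u : G) : {set G} :=
  [set v | pendant v && adj u v].

(** Stated as the equality case of the inclusion of the core neighbours of u in the rest of the
    core. *)
Definition full_core (G : sgraph) (u : G) : bool :=
  core G :\ u == [set v in core G | adj u v].

Lemma deg_sum (G : sgraph) (u : G) : deg u = \sum_(v : G) adj u v.
Proof.
rewrite /deg -sum1dep_card big_mkcond; apply: eq_bigr => v _.
by case: adj.
Qed.

Lemma adj_neq (G : sgraph) (u v : G) : adj u v -> u != v.
Proof. by apply: contraTneq => ->; rewrite adj_irrefl. Qed.

Lemma pendant_adj_uniq (G : sgraph) (u v w : G) :
  pendant u -> adj u v -> adj u w -> v = w.
Proof.
move=> /cards1P[x ux] uv uw.
have: v \in [set y | adj u y] by rewrite inE.
have: w \in [set y | adj u y] by rewrite inE.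
by rewrite ux !inE => /eqP-> /eqP->.
Qed.

Lemma connected_deg_gt0 (G : sgraph) (u : G) :
  connected G -> 1 < #|G| -> 0 < deg u.
Proof.
move=> cG /card_gt1P[x [y [_ _ xy]]].
have [v uv] : exists v, u != v.
  by case: (eqVneq u x) => [->|]; [exists y | exists x].
case/connectP: (cG u v) => -[/= _ vu | w s /= /andP[uw _] _].
  by rewrite vu eqxx in uv.
by apply/card_gt0P; exists w; rewrite inE.
Qed.

(* Two adjacent pendant vertices form a connected component. *)
Lemma connected_pendant_nadj (G : sgraph) (u v : G) :
  connected G -> 2 < #|G| -> pendant u -> pendant v -> ~~ adj u v.
Proof.
move=> cG G2 pu pv; apply/negP => uv.
have vu : adj v u by rewrite adj_sym.
have cl : closed (@adj G) [set u; v].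
  apply: intro_closed; first exact/sym_connect_sym/adj_sym.
  move=> x y xy; rewrite !inE => /orP[]/eqP ex; rewrite ex in xy.
    by rewrite (pendant_adj_uniq pu xy uv) eqxx orbT.
  by rewrite (pendant_adj_uniq pv xy vu) eqxx.
have: [set: G] \subset [set u; v].
  by apply/subsetP => w _; rewrite -(closed_connect cl (cG u w)) !inE eqxx.
by move/subset_leq_card; rewrite cardsT cards2; case: (u != v); lia.
Qed.

Lemma card_core (G : sgraph) : #|core G| = #|G| - #|[set u : G | pendant u]|.
Proof.
rewrite -(cardsC [set u : G | pendant u]) addKn; congr #|pred_of_set _|.
by apply/setP => u; rewrite !inE.
Qed.

(** Double counting of the edges between core and pendant vertices: the only neighbour of a pendant
    vertex lies in the core. *)
Lemma sum_leaves (G : sgraph) : connected G -> 2 < #|G| ->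
  \sum_(u in core G) #|leaves u| = #|[set u : G | pendant u]|.
Proof.
move=> cG G2.
rewrite (eq_bigr (fun u => \sum_(v in [set v : G | pendant v]) adj u v)); last first.
  move=> u _; rewrite -sum1_card big_mkcond [RHS]big_mkcond /=.
  by apply: eq_bigr => v _; rewrite !inE; case: pendant; case: adj.
rewrite exchange_big -sum1_card; apply: eq_bigr => v; rewrite inE => pv.
rewrite -(eqP pv) deg_sum [RHS](bigID (mem (core G))) /= [X in _ = _ + X]big1.
  by rewrite addn0; apply: eq_bigr => u _; rewrite adj_sym.
move=> u; rewrite inE negbK => pu.
by rewrite (negPf (connected_pendant_nadj cG G2 pv pu)).
Qed.

Lemma deg_core_leqif (G : sgraph) (u : G) : u \in core G ->
  deg u <= #|core G| - 1 + #|leaves u| ?= iff full_core u.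
Proof.
move=> uG; have -> : deg u = #|[set v in core G | adj u v]| + #|leaves u|.
  rewrite /deg -(cardsID (core G) [set v | adj u v]).
  by congr (_ + _); apply: eq_card => v; rewrite !inE ?negbK andbC.
rewrite (cardsD1 u (core G)) uG addKn.
have /subset_leqif_cards[le eq] : [set v in core G | adj u v] \subset core G :\ u.
  apply/subsetP => v; rewrite !inE => /andP[-> /adj_neq].
  by rewrite eq_sym => ->.
by split; rewrite ?leq_add2r // eqn_add2r eq eq_sym.
Qed.

(** Ordinal indices match the clique vertices of [clique_pendants]. *)
Lemma core_enum (G : sgraph) m : #|core G| = m ->
  exists2 e : 'I_m -> G, injective e & core G = [set e i | i in 'I_m].
Proof.
move=> <-; exists enum_val; first exact: enum_val_inj.
apply/setP => u; apply/idP/imsetP => [uG | [i _ ->]]; last exact: enum_valP.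
by exists (enum_rank_in uG u); rewrite ?enum_rankK_in.
Qed.

Lemma prod_deg_core (G : sgraph) m (e : 'I_m -> G) (F : nat -> nat) :
    injective e -> core G = [set e i | i in 'I_m] -> F 1 = 1 ->
  \prod_(u : G) F (deg u) = \prod_i F (deg (e i)).
Proof.
move=> e_inj eG F1; rewrite (bigID (mem (core G))) /= mulnC big1 ?mul1n.
  by rewrite eG big_imset //= => i j _ _; apply: e_inj.
by move=> u; rewrite inE negbK => /eqP->.
Qed.

(** Monotonicity is asked at positive arguments only, because x ^ x equals 1 at both 0 and 1;
    connectedness makes the degrees positive. *)
Lemma leqif_prod_deg (G : sgraph) m (e : 'I_m -> G) (F : nat -> nat) :
    connected G -> 2 < #|G| ->
    injective e -> core G = [set e i | i in 'I_m] ->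
    F 1 = 1 -> (forall x y, 0 < x < y -> F x < F y) ->
  \prod_(u : G) F (deg u) <= \prod_i F (m - 1 + #|leaves (e i)|)
    ?= iff [forall i, full_core (e i)].
Proof.
move=> cG G2 e_inj eG F1 Fmono; rewrite (prod_deg_core e_inj eG F1).
have eC i : e i \in core G by rewrite eG imset_f.
have mE : m = #|core G| by rewrite eG card_imset // card_ord.
have d0 i : 0 < deg (e i) by apply: connected_deg_gt0 => //; apply: ltnW.
have dF x : 0 < x -> 0 < F x.
  by case: x => [|[|x]] // _; [rewrite F1 | apply: leq_ltn_trans (Fmono 1 x.+2 _)].
apply: leqif_prod => i; have := deg_core_leqif (eC i); rewrite -mE => -[le eq].
  by apply: dF; apply: leq_trans (d0 i) le.
case: (eqVneq (deg (e i)) (m - 1 + #|leaves (e i)|)) eq => [-> | ne] <-.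
  by rewrite ?eqxx; apply/leqif_refl.
have lt : F (deg (e i)) < F (m - 1 + #|leaves (e i)|).
  by apply: Fmono; rewrite d0 ltn_neqAle ne.
by split; [apply: ltnW | rewrite ltn_eqF].
Qed.

(* Each vertex u occurs in deg u edges. *)
Lemma mult_zagreb2E (G : sgraph) : mult_zagreb2 G = \prod_(u : G) deg u ^ deg u.
Proof.
rewrite /mult_zagreb2 (exchange_big_dep predT) //=; apply: eq_bigr => u _.
rewrite prod_nat_const; congr (_ ^ _).
have inj : {in [set v | adj u v] &, injective (fun v => [set u; v])}.
  move=> v w; rewrite !inE => uv _ /setP/(_ v).
  by rewrite !inE eqxx orbT eq_sym (negPf (adj_neq uv)) => /esym/eqP.
rewrite /deg -(card_in_imset inj); apply: eq_card => A; rewrite unfold_in.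
apply/andP/imsetP => [[] | [v]].
  rewrite inE => /existsP[x /existsP[y /andP[xy /eqP->]]].
  rewrite !inE => /orP[]/eqP->; first by exists y; rewrite ?inE.
  by exists x; rewrite ?inE 1?adj_sym // setUC.
rewrite inE => uv ->; rewrite !inE eqxx; split=> //.
by apply/existsP; exists u; apply/existsP; exists v; rewrite uv eqxx.
Qed.

(** * The graphs [clique_pendants]: degrees and recognition *)

Lemma deg_clique_pendants_inl m (c : 'I_m -> nat) i :
  deg (inl i : clique_pendants c) = m - 1 + c i.
Proof.
rewrite deg_sum big_sumType /=; congr (_ + _).
  rewrite (bigD1 i) //= eqxx add0n (eq_bigr (fun=> 1)).
    by rewrite sum1_card cardC1 card_ord subn1.
  by move=> j ji; rewrite eq_sym ji.
rewrite -(sig_big_dep xpredT (fun=> xpredT) (fun j (k : 'I_(c j)) => nat_of_bool (i == j))) /=.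
rewrite (bigD1 i) //= [X in _ + X]big1 => [|j ji].
  by rewrite addn0 eqxx sum1_card card_ord.
by rewrite big1 // => _ _; rewrite eq_sym (negPf ji).
Qed.

Lemma deg_clique_pendants_inr m (c : 'I_m -> nat) w :
  deg (inr w : clique_pendants c) = 1.
Proof.
rewrite deg_sum big_sumType /= [X in _ + X]big1 // addn0 (bigD1 (tag w)) //= eqxx.
by rewrite big1 // => j /negPf->.
Qed.

Lemma graph_iso_deg (G H : sgraph) (f : G -> H) (u : G) :
  bijective f -> (forall u v, adj (f u) (f v) = adj u v) -> deg (f u) = deg u.
Proof.
move=> fb fa; rewrite !deg_sum (reindex f); last exact: onW_bij.
by apply: eq_bigr => v _; rewrite fa.
Qed.

Lemma prod_deg_clique_pendants (G : sgraph) m (c : 'I_m -> nat) (F : nat -> nat) :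
  graph_iso G (clique_pendants c) -> F 1 = 1 ->
  \prod_(u : G) F (deg u) = \prod_i F (m - 1 + c i).
Proof.
case=> f fb fa F1.
transitivity (\prod_(x : clique_pendants c) F (deg x)).
  rewrite [RHS](reindex f); last exact: onW_bij.
  by apply: eq_bigr => u _; rewrite graph_iso_deg.
rewrite big_sumType /= [X in _ * X]big1 ?muln1.
  by apply: eq_bigr => i _; rewrite deg_clique_pendants_inl.
by move=> w _; rewrite deg_clique_pendants_inr.
Qed.

(** A graph whose core is a clique is determined by its leaf counts, as every other vertex hangs at
    exactly one core vertex. *)
Lemma iso_clique_pendants (G : sgraph) m (e : 'I_m -> G) (c : 'I_m -> nat) :
    connected G -> 2 < #|G| ->
    injective e -> core G = [set e i | i in 'I_m] ->
    (forall i, full_core (e i)) -> (forall i, c i = #|leaves (e i)|) ->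
  graph_iso G (clique_pendants c).
Proof.
move=> cG G2 e_inj eG fG cE.
have eC i : e i \in core G by rewrite eG imset_f.
(* The isomorphism is built from the model to G: the k-th new vertex at i goes to the k-th leaf of
   [e i]. *)
pose g (x : clique_pendants c) : G :=
  match x with
  | inl i => e i
  | inr w => enum_val (cast_ord (cE (tag w)) (tagged w))
  end.
have gP w : g (inr w) \in leaves (e (tag w)) by apply: enum_valP.
have gpend w : pendant (g (inr w)) by have := gP w; rewrite inE => /andP[].
have gadj w : adj (g (inr w)) (e (tag w)).
  by have := gP w; rewrite inE adj_sym => /andP[].
have gnb i w : adj (e i) (g (inr w)) = (i == tag w).
  rewrite adj_sym; apply/idP/eqP => [iw | ->]; last exact: gadj.
  exact/e_inj/(pendant_adj_uniq (gpend w) iw (gadj w)).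
have epend i : ~~ pendant (e i) by have := eC i; rewrite inE.
have ge i w : e i <> g (inr w) by move=> E; have := epend i; rewrite E gpend.
have g_inj : injective g.
  case=> [i|w] [j|w'] => [/e_inj-> | /ge | /esym/ge | E] //.
  (* Equal images hang at the same core vertex, so the tags agree; then the leaf numbers can be
     compared. *)
  have := gnb (tag w) w'; rewrite -E gnb eqxx => /esym/eqP T.
  case: w w' T E {gP} => i k [j k'] /= T; case: _ / T k' => k' /enum_val_inj/cast_ord_inj.
  by move->.
(* Equal cardinalities make the injection [g] bijective. *)
have cardH : #|clique_pendants c| = #|G|.
  rewrite card_sum card_ord -[RHS](cardsC (core G)).
  rewrite {1}eG card_imset // card_ord; congr (_ + _).
  rewrite (_ : ~: core G = [set u | pendant u]); last first.
    by apply/setP => u; rewrite !inE negbK.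
  rewrite -sum_leaves // eG big_imset /=; last by move=> i j _ _; apply: e_inj.
  rewrite -sum1_card -(sig_big_dep xpredT (fun=> xpredT) (fun j (k : 'I_(c j)) => 1)) /=.
  by apply: eq_bigr => i _; rewrite sum1_card card_ord cE.
have [f gK fK] : bijective g by apply: inj_card_bij; rewrite ?cardH.
have ga x y : adj (g x) (g y) = adj x y.
  case: x y => [i|w] [j|w'].
  - have /eqP/setP/(_ (e j)) := fG i; rewrite [in RHS]inE eC /= => <-.
    by rewrite in_setD1 eC andbT (inj_eq e_inj) eq_sym.
  - exact: gnb.
  - by rewrite adj_sym; apply: gnb.
  - exact/negbTE/connected_pendant_nadj.
exists f; first by exists g.
by move=> u v; rewrite -ga !fK.
Qed.

(** * Extremal distributions of the pendant vertices *)

Lemma leqif_prod_near_clique1 m (c : 'I_m -> nat) l t :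
    0 < m - 1 + l -> t < m -> \sum_i c i = l * m + t ->
  \prod_i (m - 1 + c i) ^ 2
      <= ((m - 1 + l).+1 ^ t * (m - 1 + l) ^ (m - t)) ^ 2
    ?= iff [forall i, (c i == l) || (c i == l.+1)].
Proof.
move=> q0 tm sumc; rewrite prod_expn.
have := @leqif_prod_balanced 'I_m (fun i => m - 1 + c i) (m - 1 + l) t q0.
rewrite card_ord ltnW // big_split /= sum_nat_const card_ord sumc => /(_ isT).
(* With q = m - 1 + l, the sum is m * (m - 1) + l * m + t = m * q + t. *)
move=> /(_ ltac:(nia)) [le eq]; split; rewrite ?leq_exp2r ?eqn_exp2r //.
by rewrite eq; apply: eq_forallb => i; rewrite -addnS !eqn_add2l.
Qed.

Lemma leqif_prod_near_clique2 m (c : 'I_m -> nat) p :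
    0 < p -> \sum_i c i = p ->
  \prod_i (m - 1 + c i) ^ (m - 1 + c i)
      <= (m - 1 + p) ^ (m - 1 + p) * (m - 1) ^ ((m - 1) ^ 2)
    ?= iff [forall i, (c i == 0) || (c i == p)].
Proof.
move=> p0 sumc.
have := leqif_log_convex_prod (log_convex_shift (m - 1) selfpow_log_convex) p0 sumc.
by rewrite /= addn0 card_ord -expnM mulnn mulnC.
Qed.

(** A value below l would keep all others at most l, making the sum less than l * m; a value above l
    + 1 would keep all at least l + 1, making it exceed l * m + t. *)
Lemma balanced_sum m (c : 'I_m -> nat) l t : t < m -> \sum_i c i = l * m + t ->
  (forall i j, c i <= c j + 1) <-> [forall i, (c i == l) || (c i == l.+1)].
Proof.
move=> tm sumc; split=> [bal | /forallP cl i j]; last first.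
  by have := cl i; have := cl j; lia.
apply/forallP => i; apply/negPn/negP => ci.
have [lt | ge] := ltnP (c i) l.
  have: \sum_j c j <= \sum_(j < m | j != i) l + c i.
    by rewrite (bigD1 i) //= addnC leq_add2r leq_sum // => j _; have := bal j i; lia.
  by rewrite sum_nat_const cardC1 card_ord sumc; nia.
have: \sum_(j < m) l.+1 <= \sum_j c j.
  by rewrite leq_sum // => j _; have := bal i j; lia.
by rewrite sum_nat_const card_ord sumc; nia.
Qed.

(** One nonzero value is already p and exhausts the sum. *)
Lemma concentrated_sum m (c : 'I_m -> nat) p : 0 < p -> \sum_i c i = p ->
  [forall i, (c i == 0) || (c i == p)] ->
  exists k, forall i, (if i == k then p else 0) = c i.
Proof.
move=> p0 sumc /forallP c0p.
have [k ck] : exists k, c k != 0.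
  apply/existsP; rewrite -negb_forall; apply/negP => /forallP c0.
  by move: p0; rewrite -sumc big1 // => i _; apply/eqP.
exists k => i; have := c0p k; rewrite (negPf ck) /= => /eqP ckp.
case: eqVneq => [-> // | ik].
by move: sumc; rewrite (bigD1 k) //= ckp (bigD1 i) //=; lia.
Qed.

Theorem theorem5p1 (n p l t : nat) (G : sgraph)
    (hp : 2 <= p) (hpn : p < n) (hG : connected_pendant n p G)
    (hlt : p = l * (n - p) + t) (ht : t <= n - p - 1) :
  [/\ mult_zagreb1 G
        <= (n + l - p) ^ (2 * t) * (n + l - p - 1) ^ (2 * (n - p - t)),
      mult_zagreb2 G <= (n - 1) ^ (n - 1) * (n - p - 1) ^ ((n - p - 1) ^ 2),
      mult_zagreb1 G
        = (n + l - p) ^ (2 * t) * (n + l - p - 1) ^ (2 * (n - p - t))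
        <-> iso_Ga n p G
    & mult_zagreb2 G = (n - 1) ^ (n - 1) * (n - p - 1) ^ ((n - p - 1) ^ 2)
        <-> iso_Gs n p G].
Proof.
case: hG => cG Gn Gp; rewrite /iso_Ga /iso_Gs mult_zagreb2E /mult_zagreb1.
have G2 : 2 < #|G| by rewrite Gn; lia.
have Cm : #|core G| = n - p by rewrite card_core Gn Gp.
have -> : n + l - p = (n - p - 1 + l).+1 by lia.
have -> : n - 1 = n - p - 1 + p by lia.
rewrite subSS subn0 !(mulnC 2) ![_ ^ (_ * 2)]expnM -expnMn.
move: (n - p) Cm hlt ht (subn_gt0 p n) => m Cm hlt ht; rewrite hpn => m0.
have [e e_inj eG] := core_enum Cm.
have sumc : \sum_i #|leaves (e i)| = p.
  rewrite -Gp -sum_leaves // eG big_imset //= => i j _ _; exact: e_inj.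
(* If m = 1 then t = 0, so l = p is positive. *)
have q0 : 0 < m - 1 + l by nia.
have mono1 x y : 0 < x < y -> x ^ 2 < y ^ 2 by case/andP=> _; rewrite ltn_exp2r.
have mono2 x y : 0 < x < y -> x ^ x < y ^ y.
  case/andP=> x0 xy; apply: (@leq_trans (y ^ x)); first by rewrite ltn_exp2r.
  by rewrite leq_pexp2l ?(ltn_trans x0) // ltnW.
have tm : t < m by lia.
have p0 : 0 < p by apply: ltnW.
have isoE c := @iso_clique_pendants G m e c cG G2 e_inj eG.
(* Chaining conjoins the equality conditions: the core is a clique and the leaf counts are
   extremal. *)
have := leqif_trans (leqif_prod_deg cG G2 e_inj eG (F := expn^~ 2) erefl mono1)
  (leqif_prod_near_clique1 q0 tm (etrans sumc hlt)).
have := leqif_trans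
  (leqif_prod_deg cG G2 e_inj eG (F := fun x => x ^ x) erefl mono2)
  (leqif_prod_near_clique2 p0 sumc).
move=> -[le2 eq2] [le1 eq1]; split=> //.
- split=> [/eqP | [c [cp cbal isoc]]].
    rewrite eq1 => /andP[/forallP full bal]; exists (fun i => #|leaves (e i)|).
    by split; [| apply/(balanced_sum tm (etrans sumc hlt)) | apply: isoE].
  rewrite (prod_deg_clique_pendants (F := expn^~ 2) isoc) //.
  apply/eqP; rewrite (leqif_prod_near_clique1 q0 tm (etrans cp hlt)).
  exact/(balanced_sum tm (etrans cp hlt)).
split=> [/eqP | [k isok]].
  rewrite eq2 => /andP[/forallP full /(concentrated_sum p0 sumc)[k kP]].
  by exists k; apply: isoE.
rewrite (prod_deg_clique_pendants (F := fun x => x ^ x) isok) //.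
apply/eqP; rewrite leqif_prod_near_clique2 //.
  by apply/forallP => i; case: (i == k); rewrite eqxx ?orbT.
by rewrite -big_mkcond big_pred1_eq.
Qed.
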